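(* Let $t\ge2$, let $\kappa$ be a $t$-core with $n$-vector $(n_0,n_1,\dots,n_{t-1})$, and let $a\in\{0,1\}$. If $t\equiv 1+2a\pmod4$, then \[ \mathrm{srank}(\kappa)\equiv\sum_{i=0}^{t-1}\bigl(n_i+(1-2a)i+a\bigr)^3\pmod4; \] and if $t\equiv 2a\pmod 4$, then \[ \mathrm{srank}(\kappa)\equiv\sum_{i=0}^{t-1}\bigl(a n_i^2+(i^2+i)n_i\bigr)\pmod4. \]
   Context: For a partition $\pi$, $\pi'$ is its conjugate, $\mathcal O(\pi)$ the number of odd parts, and $\mathrm{srank}(\pi)=\mathcal O(\pi)-\mathcal O(\pi')$. A $t$-core is a partition with no rim hook (border strip) of length $t$. In the Young diagram, the cell in row $a'$ and column $b'$ is labelled by the residue of $b'-a'$ modulo $t$. For a $t$-core $\kappa$, let $r_i$ ($0\le i\le t-1$) be the number of cells of $\kappa$ labelled $i$; its $n$-vector is $(n_0,\dots,n_{t-1})=(r_0-r_1,r_1-r_2,\dots,r_{t-2}-r_{t-1},r_{t-1}-r_0)$. *)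

(* Defs.v *)
From mathcomp Require Import all_boot all_order all_algebra.
Set Implicit Arguments. Unset Strict Implicit. Unset Printing Implicit Defensive.
From mathcomp Require Import ssrint intdiv.
Import Order.TTheory GRing.Theory Num.Theory.
Local Open Scope ring_scope.

Definition is_partition (p : seq nat) : bool :=
  sorted geq p && all (fun x => (0 < x)%N) p.

Definition conjugate (p : seq nat) : seq nat :=
  mkseq (fun j => count (fun x => (j < x)%N) p) (head 0 p).

Definition odd_parts (p : seq nat) : nat := count odd p.

Definition srank (p : seq nat) : int :=
  (odd_parts p)%:Z - (odd_parts (conjugate p))%:Z.

Definition in_diagram (p : seq nat) (c : nat * nat) : bool := (c.2 < nth 0 p c.1)%N.

Definition skew_cell (lam mu : seq nat) (c : nat * nat) : bool :=
  in_diagram lam c && ~~ in_diagram mu c.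

Definition adjacent (c d : nat * nat) : bool :=
  ((c.1 == d.1) && ((c.2.+1 == d.2) || (d.2.+1 == c.2))) ||
  ((c.2 == d.2) && ((c.1.+1 == d.1) || (d.1.+1 == c.1))).

Definition is_rim_hook (t : nat) (lam mu : seq nat) : Prop :=
  [/\ is_partition mu,
      (forall c, in_diagram mu c -> in_diagram lam c),
      sumn lam = (sumn mu + t)%N,
      (forall c d, skew_cell lam mu c -> skew_cell lam mu d ->
         exists s : seq (nat * nat),
           [/\ path adjacent c s, last c s = d & all (skew_cell lam mu) s])
    & (forall i j, ~~ [&& skew_cell lam mu (i, j), skew_cell lam mu (i.+1, j),
                         skew_cell lam mu (i, j.+1) & skew_cell lam mu (i.+1, j.+1)])].

Definition is_tcore (t : nat) (lam : seq nat) : Prop :=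
  ~ exists mu, is_rim_hook t lam mu.

(* r_i: number of cells (a', b') (1-indexed; differences agree with 0-indexed)
   with (b' - a') mod t = i *)
Definition res_count (t : nat) (lam : seq nat) (i : nat) : nat :=
  (\sum_(r < size lam)
     count (fun b => ((b%:Z - (nat_of_ord r)%:Z) %% t%:Z)%Z == i%:Z) (iota 0 (nth 0 lam r)))%N.

Definition nvec (t : nat) (lam : seq nat) (i : nat) : int :=
  (res_count t lam i)%:Z - (res_count t lam ((i.+1) %% t)%N)%:Z.

(* Main.v *)
Require Import Defs.
From mathcomp Require Import all_boot all_order all_algebra.
From mathcomp Require Import ssrint intdiv.
From mathcomp Require Import zify ring.
Import Order.TTheory GRing.Theory Num.Theory.

(** Modulo 4 the indicator of an odd part [x] is [x ^ 2], and the number of odd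
    columns is the alternating sum of the rows; comparing row by row, srank is
    congruent to the sum of [x ^ 2 + x] over the beads
    [x = lambda_r + N - r - 1], [r < N], provided 4 divides the number [N] of beads.
    For a t-core the beads on each runner of the t-abacus are flush, since a bead
    with an empty place [t] below it gives a removable rim hook. If moreover 4t
    divides [N], the number of beads on runner [i] is [n_i] modulo 4, so summing
    [x ^ 2 + x] along the runners gives a polynomial in [n_i] and [i] over Z/4,
    which depends only on [t] modulo 4. *)

(** * Partitions as weakly decreasing sequences *)

Lemma nth_partition_le (p : seq nat) (i j : nat) :
  is_partition p -> (i <= j) -> (nth 0 p j <= nth 0 p i).
Proof.
move=> /andP[p_sorted _] le_ij.
have [lt_jp|] := ltnP j (size p); last by move=> ?; rewrite nth_default.
have geq_trans : transitive geq by move=> y x z /= h1 h2; exact: leq_trans h2 h1.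
by apply: (sorted_leq_nth geq_trans leqnn 0 p_sorted) => //; exact: leq_ltn_trans lt_jp.
Qed.

Lemma nth_filter_pos (s : seq nat) (j : nat) :
  sorted geq s -> nth 0 [seq x <- s | (0 < x)] j = nth 0 s j.
Proof.
have geq_trans : transitive geq by move=> y x z /= h1 h2; exact: leq_trans h2 h1.
elim: s j => [//|x s IHs] j sxs; have /= ss := path_sorted sxs.
case: x sxs => [|x] sxs /=; last by case: j => //= j; apply: IHs.
have/allP s0 := order_path_min geq_trans sxs.
have/eqP -> : [seq x <- s | (0 < x)] == [::].
  rewrite -[_ == _]negbK -has_filter; apply/hasPn => y /s0 /=; by case: y.
rewrite nth_nil; case: j => //= j.
have [lt_js|] := ltnP j (size s); last by move=> ?; rewrite nth_default.
by have /= := s0 _ (mem_nth 0 lt_js); case: (nth _ _ _).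
Qed.

Lemma sumn_filter_pos (s : seq nat) : sumn [seq x <- s | (0 < x)] = sumn s.
Proof. by elim: s => //= -[|x] s /= ->. Qed.

(** * Connected sets of cells and removal of a rim hook *)

Lemma adjacent_sym : symmetric adjacent.
Proof.
move=> c d; rewrite /adjacent [c.1 == _]eq_sym [c.2 == d.2]eq_sym.
by rewrite (orbC (c.2.+1 == d.2)) (orbC (c.1.+1 == d.1)).
Qed.

(** As in [is_rim_hook], the path need not start in [A]; hence the hypothesis [A c] in
    [connected_in_sym]. *)
Definition connected_in (A : pred (nat * nat)) (c d : nat * nat) : Prop :=
  exists s : seq (nat * nat), [/\ path adjacent c s, last c s = d & all A s].

Lemma connected_in_step (A : pred (nat * nat)) (c d e : nat * nat) :
  adjacent c d -> A d -> connected_in A d e -> connected_in A c e.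
Proof. by move=> cd Ad [s [ps ls As]]; exists (d :: s); rewrite /= cd Ad. Qed.

Lemma connected_in_trans (A : pred (nat * nat)) (c d e : nat * nat) :
  connected_in A c d -> connected_in A d e -> connected_in A c e.
Proof.
move=> [s [ps ls As]] [s' [ps' ls' As']]; exists (s ++ s').
by rewrite cat_path last_cat all_cat ls ps As ps' As'.
Qed.

Lemma connected_in_sym (A : pred (nat * nat)) (c d : nat * nat) :
  A c -> connected_in A c d -> connected_in A d c.
Proof.
move=> Ac [s [ps <- As]] {d}.
elim: s c Ac ps As => [|e s IHs] c Ac /=; first by exists [::].
move=> /andP[ce ps] /andP[Ae As].
apply: connected_in_trans (IHs e Ae ps As) _.
by apply: (connected_in_step _ e c c); rewrite 1?adjacent_sym //; exists [::].
Qed.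

(* In the encoding by first-column hook lengths, removing a rim hook moves one
   bead down; the bead of row [r] becomes the bead of row [s], with part [m],
   and the rows [r + 1 .. s] slide up by one, losing one cell each. *)
Definition unhook (p : seq nat) (r s m j : nat) : nat :=
  if (r <= j < s) then (nth 0 p j.+1).-1 else if j == s then m else nth 0 p j.

Section Unhook.

Context (p : seq nat) (r s m : nat) (pp : is_partition p) (rs : (r <= s))
  (m_bounds : (nth 0 p s.+1 <= m < nth 0 p s)).

(** Positivity in the second case holds because row [j.+1] is at least as long as row [s], which
    exceeds [m]; so the predecessor is a true subtraction. *)
Lemma unhook_spec (j : nat) :
  [\/ (j < r) /\ unhook p r s m j = nth 0 p j,
      [/\ (r <= j < s), unhook p r s m j = (nth 0 p j.+1).-1
        & (0 < nth 0 p j.+1)],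
      j = s /\ unhook p r s m j = m
    | (s < j) /\ unhook p r s m j = nth 0 p j].
Proof.
rewrite /unhook; case: ifP => [js|js].
  apply: Or42; split=> //.
  have := nth_partition_le p j.+1 s pp; lia.
case: eqP => [->|js']; first by apply: Or43.
have [?|?] := ltnP j r; [apply: Or41 | apply: Or44]; split=> //; lia.
Qed.

Lemma unhook_le (j : nat) : (unhook p r s m j <= nth 0 p j).
Proof.
have H := nth_partition_le p j j.+1 pp (leqnSn _).
by case: (unhook_spec j) => [[? ->]|[? -> ?]|[-> ->]|[? ->]] //; lia.
Qed.

Lemma unhook_antitone (j : nat) : (unhook p r s m j.+1 <= unhook p r s m j).
Proof.
have H1 := nth_partition_le p j j.+1 pp (leqnSn _).
have H2 := nth_partition_le p j.+1 j.+2 pp (leqnSn _).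
case: (unhook_spec j) => [[? ->]|[? -> ?]|[? ->]|[? ->]];
case: (unhook_spec j.+1) => [[? ->]|[? -> ?]|[? ->]|[? ->]]; subst; try lia.
Qed.

Lemma sum_unhook (n t : nat) :
  (s < n) -> (nth 0 p r + s = m + r + t) ->
  (\sum_(j < n) nth 0 p j = \sum_(j < n) unhook p r s m j + t).
Proof.
move=> sn hook_len.
(* For [r < k <= s] the losses [p_j - p_(j+1) + 1] of the rows [r <= j < k] telescope; row [s] then
   loses [p_s - m], which completes [t]. *)
suff H k : (\sum_(j < k) nth 0 p j = \sum_(j < k) unhook p r s m j +
    (if k <= r then 0 else if k <= s then nth 0 p r + k - r - nth 0 p k else t)).
  by rewrite H !ifF //; lia.
elim: k => [|k IHk]; first by rewrite !big_ord0.
rewrite !big_ord_recr /= {}IHk -!addnA; congr addn.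
have H1 := nth_partition_le p k k.+1 pp (leqnSn _).
have H2 := nth_partition_le p r k pp.
have H3 := nth_partition_le p r k.+1 pp.
have H0 : r = k -> nth 0 p r = nth 0 p k by move=> ->.
have H4 : k = s -> nth 0 p k = nth 0 p s by move=> ->.
case: (unhook_spec k) => [[? ->]|[? -> ?]|[? ->]|[? ->]];
  do ![case: ifP => ?]; lia.
Qed.

(** Walk right to the end of the row, then up, until the last cell of row [r]; each step decreases
    [nth 0 p r + j - b]. *)
Lemma unhook_skew_connected (j b : nat) :
  let A c := (c.2 < nth 0 p c.1) && ~~ (c.2 < unhook p r s m c.1) in
  A (j, b) -> connected_in A (j, b) (r, (nth 0 p r).-1).
Proof.
move=> A; move: {2}(nth 0 p r + j - b) (leqnn (nth 0 p r + j - b)) => n.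
elim: n j b => [|n IHn] j b le_n Ajb.
all: have := Ajb; rewrite /A /= -leqNgt => /andP[b1 b2].
all: have H1 := nth_partition_le p r j pp.
all: have rj : (r <= j) by case: (unhook_spec j) => [[? e]|[? e ?]|[? e]|[? e]]; lia.
  lia.
have [lt_b|ge_b] := ltnP b.+1 (nth 0 p j).
  have Ab : A (j, b.+1) by rewrite /A /= lt_b -leqNgt; lia.
  apply: (connected_in_step A (j, b) (j, b.+1)) => //.
    by rewrite /adjacent /= !eqxx.
  by apply: IHn => //; lia.
have eb : b = (nth 0 p j).-1 by lia.
have [ejr|nejr] := eqVneq j r.
  by rewrite eb ejr; exists [::].
case: j => [|j] in le_n Ajb b1 b2 H1 rj ge_b eb nejr *; first by lia.
(* Here [b] is the last column of row [j.+1], and row [j] keeps exactly [b] cells, so the cell above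
   is removed too. *)
have Ab : A (j, b).
  have H2 := nth_partition_le p j j.+1 pp (leqnSn _).
  rewrite /A /= -leqNgt.
  case: (unhook_spec j.+1) => [[? e]|[? e ?]|[? e]|[? e]];
  case: (unhook_spec j) => [[? e']|[? e' ?]|[? e']|[? e']]; lia.
apply: (connected_in_step A (j.+1, b) (j, b)) => //.
  by rewrite /adjacent /= !eqxx !orbT.
by apply: IHn => //; lia.
Qed.

End Unhook.

(** With the bead of row [j] at [p_j - j], the bounds on [m] put the place [m - s] strictly between
    the beads of rows [s.+1] and [s], and the last equation puts it [t] below the bead of row
    [r]. *)
Lemma rim_hook_removal (t : nat) (p : seq nat) (r s m : nat) :
  is_partition p -> (r <= s) -> (nth 0 p s.+1 <= m < nth 0 p s) ->
  (nth 0 p r + s = m + r + t) -> exists mu, is_rim_hook t p mu.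
Proof.
move=> pp rs m_bounds hook_len.
have sn : (s < size p) by rewrite ltnNge; apply/negP => /(nth_default 0); lia.
pose mu0 := mkseq (unhook p r s m) (size p).
have nth_mu0 j : nth 0 mu0 j = unhook p r s m j.
  have [jn|nj] := ltnP j (size p); first by rewrite nth_mkseq.
  rewrite nth_default ?size_mkseq //.
  have := unhook_le p r s m pp rs m_bounds j.
  by rewrite nth_default //; case: unhook.
have mu0_sorted : sorted geq mu0.
  apply/(sortedP 0) => j _ /=; rewrite !nth_mu0; exact: unhook_antitone.
pose mu := [seq x <- mu0 | (0 < x)].
have nth_mu j : nth 0 mu j = unhook p r s m j by rewrite nth_filter_pos.
pose A c := (c.2 < nth 0 p c.1) && ~~ (c.2 < unhook p r s m c.1).
have skewE : skew_cell p mu =1 A.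
  by move=> c; rewrite /skew_cell /in_diagram nth_mu.
exists mu; split.
- apply/andP; split; last exact: filter_all.
  by apply: sorted_filter => // y x z /= h1 h2; exact: leq_trans h2 h1.
- move=> c; rewrite /in_diagram nth_mu => /leq_trans; apply.
  exact: unhook_le.
- rewrite sumn_filter_pos !sumnE [in RHS]big_map -/(iota 0 _).
  rewrite -[X in iota 0 X]subn0 big_mkord -(sum_unhook p r s m pp rs m_bounds _ t) //.
  by rewrite (big_nth 0) big_mkord.
- move=> [j b] [j' b']; rewrite !skewE => Ac Ad.
  have := unhook_skew_connected p r s m pp rs m_bounds _ _ Ac.
  have /(connected_in_sym _ _ _ Ad) := unhook_skew_connected p r s m pp rs m_bounds _ _ Ad.
  move=> cd cc; case: (connected_in_trans _ _ _ _ cc cd) => q [h1 h2 h3].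
  by exists q; split=> //; rewrite (eq_all skewE).
(* If rows [i] and [i.+1] both lose cells, row [i] keeps [p_(i+1) - 1] of them, so [(i, j)] and
   [(i.+1, j.+1)] are never both removed. *)
- move=> i j; rewrite !skewE /A /=; apply/negP => /and4P[h1 h2 h3 h4].
  have H := nth_partition_le p i.+1 i.+2 pp (leqnSn _).
  case: (unhook_spec p r s m pp rs m_bounds i) => [[? e]|[? e ?]|[? e]|[? e]];
  case: (unhook_spec p r s m pp rs m_bounds i.+1) => [[? e']|[? e' ?]|[? e']|[? e']]; lia.
Qed.

(** * Beads and runners of the abacus *)

Definition beta (N : nat) (p : seq nat) : seq nat :=
  mkseq (fun r => nth 0 p r + (N - r.+1)) N.

Lemma beta_uniq (N : nat) (p : seq nat) : is_partition p -> uniq (beta N p).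
Proof.
move=> pp; apply/mkseq_uniqP => i j; rewrite !inE => iN jN e.
have := nth_partition_le p i j pp; have := nth_partition_le p j i pp; lia.
Qed.

Lemma tcore_beta_closed (t N : nat) (p : seq nat) (x : nat) :
  is_partition p -> is_tcore t p -> (size p <= N) ->
  (x + t) \in beta N p -> x \in beta N p.
Proof.
move=> pp core_p le_pN /mapP[r]; rewrite mem_iota /= => rN x_r.
apply/negPn/negP => x_notin; apply: core_p.
have x_neq s : (s < N) -> x != (nth 0 p s + (N - s.+1)).
  move=> sN; apply: contra x_notin => /eqP ->.
  by apply: map_f; rewrite mem_iota.
(* The moved bead takes the place of the last row [s] whose bead lies above [x]. *)
pose P s := (s < N) && (x < nth 0 p s + (N - s.+1)).
have Pr : P r by rewrite /P rN /=; have := x_neq r rN; lia.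
have ubP i : P i -> (i <= N) by case/andP => /ltnW.
case: (ex_maxnP (ex_intro P r Pr) ubP) => s /andP[sN x_s] s_max.
have rs := s_max r Pr.
(* If [s.+1 = N], the default part 0 serves. The bound also makes [x + s.+1 - N] below a true
   subtraction. *)
have next : (nth 0 p s.+1 + N <= x + s.+1).
  have [s1N|Ns1] := ltnP s.+1 N; last by rewrite nth_default; lia.
  have := x_neq _ s1N; have : ~~ P s.+1 by apply/negP => /s_max; lia.
  by rewrite /P s1N /=; lia.
apply: (rim_hook_removal t p r s (x + s.+1 - N)) => //; lia.
Qed.

Local Open Scope ring_scope.

Lemma perm_iota_closed (Y : seq nat) :
  uniq Y -> (forall m, m.+1 \in Y -> m \in Y) -> perm_eq Y (iota 0 (size Y)).
Proof.
move=> uY closedY.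
have down m k : (m + k)%N \in Y -> m \in Y.
  by elim: k => [|k IHk]; rewrite ?addn0 // addnS => /closedY.
have subY : {subset Y <= iota 0 (size Y)}.
  move=> m mY; rewrite mem_iota /= -(size_iota 0 m.+1).
  apply: uniq_leq_size (iota_uniq _ _) _ => k; rewrite mem_iota => /= km.
  by apply: (down k (m - k)%N); rewrite subnKC.
apply: uniq_perm => //; first exact: iota_uniq.
by case: (uniq_min_size uY subY) => //; rewrite size_iota.
Qed.

(** The quotients by [t] of the elements in one residue class are closed downwards, hence form an
    initial interval determined by its size. *)
Lemma sum_runners (R : nmodType) (t : nat) (X : seq nat) (f : nat -> R) :
  (0 < t)%N -> uniq X -> (forall x, (x + t)%N \in X -> x \in X) ->
  \sum_(x <- X) f x =
  \sum_(i < t) \sum_(m < count (fun x => x %% t == i)%N X) f (i + m * t)%N.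
Proof.
move=> t_gt0 uX closedX.
rewrite (partition_big (fun x => Ordinal (ltn_pmod x t_gt0)) xpredT) //=.
apply: eq_bigr => i _; set Xi := [seq x <- X | x %% t == i]%N.
have XiE x : x \in Xi -> x = (i + x %/ t * t)%N.
  by rewrite mem_filter => /andP[/eqP <- _]; rewrite addnC -divn_eq.
pose Y := [seq (x %/ t)%N | x <- Xi].
have memY m : (m \in Y) = ((i + m * t)%N \in X).
  apply/mapP/idP => [[x xXi ->]|mX].
    by rewrite -XiE //; move: xXi; rewrite mem_filter => /andP[].
  exists (i + m * t)%N; last by rewrite addnC divnMDl // divn_small ?addn0.
  by rewrite mem_filter mX andbT addnC modnMDl modn_small.
have uY : uniq Y.
  rewrite map_inj_in_uniq ?filter_uniq // => x y xXi yXi e.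
  by rewrite (XiE x xXi) (XiE y yXi) e.
have closedY m : m.+1 \in Y -> m \in Y.
  by rewrite !memY mulSn addnCA addnC => /closedX.
rewrite -big_filter (_ : [seq _ <- X | _] = Xi); last by apply: eq_filter.
rewrite (eq_big_seq (fun x => f (i + x %/ t * t)%N)); last first.
  by move=> x /XiE {1}->.
rewrite -(big_map (fun x => x %/ t)%N xpredT (fun m => f (i + m * t)%N)).
rewrite (perm_big _ (perm_iota_closed Y uY closedY)) size_map size_filter.
by rewrite -[X in iota 0 X]subn0 big_mkord.
Qed.

(** * Odd parts of a partition and of its conjugate *)

(** Columns beyond the first row are empty; a free bound [M] allows two conjugates to be compared
    over one range. *)
Lemma odd_parts_conjugateE (M : nat) (p : seq nat) :
  is_partition p -> (head 0 p <= M)%N ->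
  odd_parts (conjugate p) = (\sum_(j < M) odd (count (fun x => j < x) p))%N.
Proof.
move=> pp le_pM; rewrite /odd_parts /conjugate count_map -sum1_count big_mkcond /=.
rewrite -[X in iota 0 X]subn0 big_mkord -(subnKC le_pM) big_split_ord /=.
rewrite [X in (_ + X)%N]big1 ?addn0 => [|j _].
  by apply: eq_bigr => j _; case: odd.
rewrite (_ : count _ p = 0%N) //; apply/eqP.
rewrite -leqn0 leqNgt -has_count; apply/hasPn => x /(nthP 0%N)[k _ <-].
have := nth_partition_le p 0%N k pp (leq0n _); rewrite nth0 /=; lia.
Qed.

Lemma is_partition_cons (x : nat) (p : seq nat) :
  is_partition (x :: p) -> is_partition p.
Proof. by case/andP => /path_sorted h1 /andP[_ h2]; apply/andP. Qed.

(** A new first row of length [x] flips the parity of each of the [x] columns, so each column is odd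
    in exactly one of the two diagrams. *)
Lemma odd_parts_conjugate_cons (x : nat) (p : seq nat) :
  is_partition (x :: p) ->
  (odd_parts (conjugate (x :: p)) + odd_parts (conjugate p))%N = x.
Proof.
move=> pxp; have pp := is_partition_cons x p pxp.
have le_px : (head 0 p <= x)%N.
  by have := nth_partition_le _ 0%N 1%N pxp isT; rewrite /= nth0.
rewrite (odd_parts_conjugateE x _ pxp) // (odd_parts_conjugateE x p) //.
rewrite -big_split /= -[RHS]card_ord -sum1_card; apply: eq_bigr => j _.
by rewrite ltn_ord add1n /=; case: odd.
Qed.

Lemma odd_parts_conjugate_alternating (N : nat) (p : seq nat) :
  is_partition p -> (size p <= N)%N ->
  (odd_parts (conjugate p))%:Z = \sum_(r < N) (-1) ^+ r * (nth 0%N p r)%:Z.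
Proof.
elim: p N => [|x p IHp] N pxp le_N.
  by rewrite big1 // => r _; rewrite nth_nil mulr0.
case: N le_N => // N le_N; have pp := is_partition_cons x p pxp.
rewrite big_ord_recl /= expr0 mul1r -{2}(odd_parts_conjugate_cons x p pxp).
rewrite PoszD (eq_bigr (fun i : 'I_N => - ((-1) ^+ i * (nth 0%N p i)%:Z))).
  by rewrite sumrN -(IHp N pp le_N) addrK.
by move=> i _; rewrite /bump /= add1n exprS mulN1r mulNr.
Qed.

Lemma odd_parts_sum (N : nat) (p : seq nat) :
  (size p <= N)%N -> odd_parts p = (\sum_(r < N) odd (nth 0 p r))%N.
Proof.
move=> le_N; rewrite /odd_parts -sum1_count big_mkcond (big_nth 0%N) big_mkord.
rewrite -(subnKC le_N) big_split_ord /= [X in (_ + X)%N]big1 ?addn0 => [|j _].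
  by apply: eq_bigr => j _; case: odd.
by rewrite nth_default ?leq_addr.
Qed.

(** * Arithmetic in Z/4 and srank as a sum over beads *)

(** Moves the congruence to a finite ring, where polynomial identities can be checked on all values
    by [Z4_ind]. *)
Lemma eq_mod4 (x y : int) : x%:~R = y%:~R :> 'Z_4 -> (x = y %[mod 4])%Z.
Proof.
move=> exy; apply/eqP; rewrite eqz_mod_dvd.
have: (x - y)%:~R = 0 :> 'Z_4 by rewrite rmorphB /= exy subrr.
have natr0 n : n%:R = 0 :> 'Z_4 -> (4 %| n)%N.
  by move/(congr1 (@nat_of_ord _)); rewrite val_Zp_nat // => /eqP.
case: (x - y) => n; first by move/natr0.
by rewrite NegzE rmorphN /= => /eqP; rewrite oppr_eq0 => /eqP/natr0.
Qed.

Lemma natr_Z4 (n : nat) : n%:R = (n %% 4)%:R :> 'Z_4.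
Proof. by rewrite Zp_nat_mod. Qed.

Lemma natr4M (n : nat) : (4 * n)%:R = 0 :> 'Z_4.
Proof. by rewrite natr_Z4 modnMr. Qed.

Lemma Z4_ind (P : 'Z_4 -> Prop) : P 0 -> P 1 -> P 2%:R -> P 3%:R -> forall x, P x.
Proof.
move=> P0 P1 P2 P3 [[|[|[|[|//]]]] lt_x].
- by rewrite (_ : Ordinal _ = 0) //; apply: val_inj.
- by rewrite (_ : Ordinal _ = 1) //; apply: val_inj.
- by rewrite (_ : Ordinal _ = 2%:R) //; apply: val_inj.
- by rewrite (_ : Ordinal _ = 3%:R) //; apply: val_inj.
Qed.

(** Any four consecutive integers run once through Z/4, so each block of four contributes 0. *)
Lemma sum_period4 (f : 'Z_4 -> 'Z_4) (k d : nat) :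
  \sum_x f x = 0 -> \sum_(i < 4 * k + d) f i%:R = \sum_(i < d) f i%:R.
Proof.
move=> f0; elim: k => // k <-; rewrite mulnS -addnA addnC.
move: (4 * k + d)%N => n; rewrite big_split_ord /= -[RHS]addr0; congr (_ + _).
rewrite -[RHS]f0 [RHS](reindex_inj (addrI n%:R)).
by apply: eq_bigr => j _; rewrite natrD (natr_Zp (j : 'Z_4)).
Qed.

Definition pronic (x : 'Z_4) : 'Z_4 := x ^+ 2 + x.

Lemma sum_pronic (k : nat) : \sum_(i < 4 * k) pronic i%:R = 0.
Proof.
rewrite -[(4 * k)%N]addn0 sum_period4 ?big_ord0 //.
by rewrite !big_ord_recl big_ord0; apply/eqP.
Qed.

(* Both sides are twice the sum of the contents of row [r], of length [l]. *)
Lemma srank_row (l r k : nat) :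
  (r < 4 * k)%N ->
  (odd l)%:R - (-1) ^+ r * l%:R =
  pronic (l + (4 * k - r.+1))%:R - pronic (4 * k - r.+1)%:R.
Proof.
move=> lt_r; set s := (4 * k - r.+1)%N.
have odd_r : odd r = ~~ odd s by rewrite /s; lia.
rewrite -signr_odd odd_r signrN natrD (natr_Z4 l) (natr_Z4 s).
rewrite -(@odd_mod l 4) // -(@odd_mod s 4) //.
case: (l %% 4)%N (ltn_pmod l (isT : 0 < 4)%N) => [|[|[|[|//]]]] _;
case: (s %% 4)%N (ltn_pmod s (isT : 0 < 4)%N) => [|[|[|[|//]]]] _; exact/eqP.
Qed.

Lemma srank_beta (k : nat) (p : seq nat) :
  is_partition p -> (size p <= 4 * k)%N ->
  (srank p)%:~R = \sum_(x <- beta (4 * k) p) pronic x%:R.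
Proof.
move=> pp le_pN; rewrite /srank (odd_parts_conjugate_alternating _ p pp le_pN).
rewrite (odd_parts_sum _ p le_pN) rmorphB /= -pmulrn natr_sum rmorph_sum /= -sumrB.
rewrite /beta /mkseq big_map -[X in iota 0 X]subn0 big_mkord.
(* The beads of the empty partition have pronic sum 0; subtracting them, in reversed order, allows a
   comparison row by row. *)
have := sum_pronic k; rewrite (reindex_inj rev_ord_inj) /= => sum0.
rewrite -[RHS]subr0 -[X in _ = _ - X]sum0 -sumrB.
apply: eq_bigr => r _; rewrite -srank_row // rmorphM /= rmorphXn rmorphN1 /=.
by rewrite -pmulrn.
Qed.

(** * The n-vector as bead counts on the runners *)

Lemma count_mod_iota (t q i : nat) :
  (i < t)%N -> count (fun x => x %% t == i)%N (iota 0 (q * t)) = q.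
Proof.
move=> lt_it; elim: q => // q IHq.
rewrite mulSn addnC iotaD count_cat IHq add0n -[(q * t)%N]addn0.
rewrite iotaDl count_map -[RHS]addn1; congr addn.
have <- : count_mem i (iota 0 t) = 1%N.
  by rewrite count_uniq_mem ?iota_uniq // mem_iota lt_it.
apply: eq_in_count => x; rewrite mem_iota => /= lt_xt.
by rewrite modnMDl modn_small.
Qed.

(** The left count tests the values [s + 1, ..., s + l] against [i], the right one
    [s, ..., s + l - 1]; only the two end values differ. *)
Lemma count_residue_row (t i s l : nat) :
  (i < t)%N ->
  (count (fun b => (b + s.+1) %% t == i) (iota 0 l) + (s %% t == i) =
   count (fun b => (b + s.+1) %% t == i.+1 %% t) (iota 0 l) + ((l + s) %% t == i))%N.
Proof.
move=> lt_it; elim: l => [//|l IHl].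
rewrite -[l.+1]addn1 iotaD !count_cat /= !addn0 !add0n.
have -> : ((l + s.+1) %% t == i.+1 %% t)%N = ((l + s) %% t == i)%N.
  by rewrite addnS -[(l + s).+1]addn1 -[i.+1]addn1 eqn_modDr (modn_small lt_it).
by rewrite addnAC IHl -[(l + 1 + s)%N]addnA add1n.
Qed.

(** By [count_residue_row], each row contributes the change on runner [i] between its bead and the
    bead of an empty row; the empty partition has [q] beads on every runner. *)
Lemma nvec_beta (t q i : nat) (p : seq nat) :
  (i < t)%N -> (size p <= q * t)%N ->
  nvec t p i = (count (fun x => x %% t == i)%N (beta (q * t) p))%:Z - q%:Z.
Proof.
move=> lt_it le_pN; set N := (q * t)%N in le_pN *.
have t_gt0 : (0 < t)%N by exact: leq_ltn_trans lt_it.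
have res_countE j : res_count t p j =
    (\sum_(r < N) count (fun b => (b + (N - r.+1).+1) %% t == j) (iota 0 (nth 0 p r)))%N.
  rewrite /res_count -(subnKC le_pN) big_split_ord /= [X in (_ + X)%N]big1 ?addn0 => [|r _].
    apply: eq_bigr => r _; apply: eq_count => b; rewrite subnKC //.
    have lt_rN : (r < N)%N by exact: leq_trans le_pN.
    (* Adding [N], a multiple of [t], turns the content into a natural number of the same
       residue. *)
    rewrite (_ : b%:Z - r%:Z = (- q%:Z) * t%:Z + (b + (N - r.+1).+1)%N%:Z).
      by rewrite modzMDl modz_nat.
    by rewrite subnSK // PoszD -subzn 1?ltnW // /N PoszM; ring.
  by rewrite nth_default ?leq_addr.
rewrite -[q in RHS](count_mod_iota t q i lt_it) -/N /nvec !res_countE.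
have -> : count (fun x => x %% t == i)%N (iota 0 N) =
    (\sum_(r < N) ((N - r.+1) %% t == i))%N.
  rewrite -sum1_count big_mkcond -[X in iota 0 X]subn0 big_mkord.
  by rewrite (reindex_inj rev_ord_inj); apply: eq_bigr => r _ /=; case: eqP.
have -> : count (fun x => x %% t == i)%N (beta N p) =
    (\sum_(r < N) ((nth 0 p r + (N - r.+1)) %% t == i))%N.
  rewrite /beta /mkseq count_map -sum1_count big_mkcond -[X in iota 0 X]subn0 big_mkord.
  by apply: eq_bigr => r _ /=; case: eqP.
apply/eqP; rewrite subr_eq addrAC eq_sym subr_eq -!PoszD -!big_split /= eq_sym.
by apply/eqP; apply: (congr1 Posz); apply: eq_bigr => r _; rewrite count_residue_row // addnC.
Qed.

(* [F i c] evaluates the pronic sum over the first [c] beads of runner [i] as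
   [G i c] up to a multiple of [c] and a term in [i]; both vanish after summing
   over the runners. *)
Lemma srank_tcore (t : nat) (p : seq nat) (G : 'Z_4 -> 'Z_4 -> 'Z_4)
    (e : 'Z_4) (h : 'Z_4 -> 'Z_4) (F := fun i c => G i c + e * c + h i) :
  (0 < t)%N -> is_partition p -> is_tcore t p ->
  (forall i, F i 0 = 0) ->
  (forall i c, F i (c + 1) = F i c + pronic (i + c * (t %% 4)%:R)) ->
  \sum_x h x = 0 -> \sum_(i < t %% 4) h i%:R = 0 ->
  (srank p)%:~R = \sum_(i < t) G i%:R (nvec t p i)%:~R.
Proof.
move=> t_gt0 pp core_p F0 FS sum4_h sum_h.
have {}sum_h : \sum_(i < t) h i%:R = 0.
  by rewrite (divn_eq t 4) mulnC sum_period4.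
pose q := (4 * size p)%N; pose N := (q * t)%N.
have NE : N = (4 * (size p * t))%N by rewrite /N /q mulnA.
have le_pN : (size p <= N)%N by rewrite NE; nia.
pose X := beta N p; pose c (i : nat) := count (fun x => x %% t == i)%N X.
have runners (f : nat -> 'Z_4) :=
  sum_runners _ t X f t_gt0 (beta_uniq N p pp)
    (fun x => tcore_beta_closed t N p x pp core_p le_pN).
have nvecE (i : 'I_t) : (nvec t p i)%:~R = (c i)%:R :> 'Z_4.
  by rewrite (nvec_beta t q) // rmorphB /= -!pmulrn (natr4M (size p)) subr0.
have sum_c : \sum_(i < t) (c i)%:R = 0 :> 'Z_4.
  transitivity (\sum_(x <- X) (1 : 'Z_4)).
    by rewrite runners; apply: eq_bigr => i _; rewrite sumr_const card_ord.
  by rewrite big_const_seq count_predT iter_addr_0 size_mkseq NE natr4M.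
rewrite (srank_beta (size p * t)) -?NE // -/X runners.
transitivity (\sum_(i < t) F i%:R (c i)%:R).
  apply: eq_bigr => i _; rewrite -/(c i); elim: (c i) => [|m IHm].
    by rewrite big_ord0 F0.
  by rewrite big_ord_recr /= IHm -[m.+1%:R]natr1 FS -natr_Z4 natrD natrM.
rewrite !big_split /= sum_h -mulr_sumr sum_c mulr0 !addr0.
by apply: eq_bigr => i _; rewrite nvecE.
Qed.

Theorem theorem4 (t : nat) (kappa : seq nat) (a : nat) :
  (2 <= t)%N -> is_partition kappa -> is_tcore t kappa -> (a <= 1)%N ->
  ((t %% 4 = (1 + 2 * a) %% 4)%N ->
     (srank kappa = \sum_(i < t)
        (nvec t kappa i + (1 - 2 * a%:Z) * (nat_of_ord i)%:Z + a%:Z) ^+ 3 %[mod 4])%Z)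
  /\
  ((t %% 4 = (2 * a) %% 4)%N ->
     (srank kappa = \sum_(i < t)
        (a%:Z * nvec t kappa i ^+ 2
         + ((nat_of_ord i)%:Z ^+ 2 + (nat_of_ord i)%:Z) * nvec t kappa i) %[mod 4])%Z).
Proof.
move=> t_ge2 pp core_p; have t_gt0 : (0 < t)%N := ltnW t_ge2.
case: a => [|[|//]] _; split=> t_mod; apply: eq_mod4; rewrite rmorph_sum /=.
(* Case [t = 1] mod 4: with [x = c + i], [(x + 1)^3 - x^3 - 1 = 3(x^2 + x)], which is [x^2 + x] in
   Z/4 since [x^2 + x] is even. The term [h] makes [F i 0] vanish. *)
- rewrite (srank_tcore t kappa (fun i c => (c + i) ^+ 3) (-1) (fun i => - i ^+ 3)) //.
  + apply: eq_bigr => i _; rewrite rmorphXn !rmorphD rmorphM /= -pmulrn.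
    by congr (_ ^+ 3); ring.
  + by elim/Z4_ind; apply/eqP.
  + by rewrite t_mod; elim/Z4_ind; elim/Z4_ind; apply/eqP.
  + by rewrite !big_ord_recl big_ord0; apply/eqP.
  + by rewrite t_mod !big_ord_recl big_ord0; apply/eqP.
(* Case [t = 0] mod 4: every bead of runner [i] is [i] in Z/4, so the sum is linear in [c]. *)
- rewrite (srank_tcore t kappa (fun i c => (i ^+ 2 + i) * c) 0 (fun=> 0)) //.
  + apply: eq_bigr => i _; rewrite !(rmorphD, rmorphXn, rmorphM) /= -?pmulrn.
    by ring.
  + by elim/Z4_ind; apply/eqP.
  + by rewrite t_mod; elim/Z4_ind; elim/Z4_ind; apply/eqP.
  + by rewrite big1.
  + by rewrite big1.
(* Case [t = 3] mod 4: the beads are [i - c], and [h] takes the same values on Z/4 as [(i - 1)^3],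
   which cancels [G i 0]. *)
- rewrite (srank_tcore t kappa (fun i c => (c - i + 1) ^+ 3) 1
    (fun i => (i + 1) ^+ 3 - 2%:R * (i + 1))) //.
  + apply: eq_bigr => i _; rewrite rmorphXn !rmorphD rmorphM /= -pmulrn.
    by congr (_ ^+ 3); ring.
  + by elim/Z4_ind; apply/eqP.
  + by rewrite t_mod; elim/Z4_ind; elim/Z4_ind; apply/eqP.
  + by rewrite !big_ord_recl big_ord0; apply/eqP.
  + by rewrite t_mod !big_ord_recl big_ord0; apply/eqP.
(* Case [t = 2] mod 4: the pronic value of [i + 2c] is [i^2 + i + 2c], and [2c] is the increment of
   [c^2 - c]. *)
- rewrite (srank_tcore t kappa (fun i c => c ^+ 2 + (i ^+ 2 + i) * c) (-1) (fun=> 0)) //.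
  + apply: eq_bigr => i _; rewrite !(rmorphD, rmorphXn, rmorphM) /= -?pmulrn.
    by ring.
  + by elim/Z4_ind; apply/eqP.
  + by rewrite t_mod; elim/Z4_ind; elim/Z4_ind; apply/eqP.
  + by rewrite big1.
  + by rewrite big1.
Qed.
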